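(* If $\mathcal{P}$ is a tight orientably-regular abstract polytope of type $\{p_1,\ldots,p_{n-1}\}$, then the $(n-1)$-tuple $(p_1,\ldots,p_{n-1})$ is admissible.
   Context: An abstract polytope of rank $n$ is a ranked poset (ranks $-1$ to $n$) with unique least and greatest faces, all flags (maximal chains) having $n+2$ faces, all sections connected, and the diamond condition. It has type $\{p_1,\ldots,p_{n-1}\}$ if for each $i$, every section $G/F$ with $F$ an $(i-2)$-face and $G$ an $(i+1)$-face is a $p_i$-gon; it is tight if it has exactly $2p_1\cdots p_{n-1}$ flags. It is regular if its automorphism group acts transitively on flags (generated then by reflections $\rho_0,\ldots,\rho_{n-1}$ with respect to a base flag), and orientably-regular if the rotation subgroup $\langle\rho_{i-1}\rho_i : 1\le i\le n-1\rangle$ has index $2$. An $(n-1)$-tuple $(p_1,\ldots,p_{n-1})$ is admissible if whenever $p_i$ is odd, each of $p_{i-1}$ and $p_{i+1}$ (when its index lies in $\{1,\ldots,n-1\}$) is an even divisor of $2p_i$. *)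

(* Defs.v *)
From HB Require Import structures.
From mathcomp Require Import all_boot all_order all_algebra.
From mathcomp Require Import mathcomp_extra boolp classical_sets functions.
From mathcomp Require Import cardinality.

Set Implicit Arguments.
Unset Strict Implicit.
Unset Printing Implicit Defensive.

Import Order.TTheory GRing.Theory Num.Theory.

Local Open Scope classical_set_scope.
Local Open Scope card_scope.
Local Open Scope order_scope.

Section Posets.
Context {disp : Order.disp_t} {T : tbPOrderType disp}.
Implicit Types (F G H K : T) (C D : set T).

Definition chain C := total_on C (fun F G => F <= G).

Definition is_flag C := chain C /\ forall D, chain D -> C `<=` D -> D `<=` C.

Definition flags : set (set T) := [set C | is_flag C].

Definition section F G : set T := [set H | F <= H <= G].

(* The proper faces of G / F are its faces other than F and G; two faces are
   incident when they are comparable.  The sequence of faces joining H to K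
   is H :: s. *)
Definition section_connected F G :=
  forall H K, F < H < G -> F < K < G ->
    exists s : seq T,
      [/\ all (fun L => F < L < G) s, path (fun L M => L >=< M) H s
        & last H s = K].

Definition automorphism (f : T -> T) :=
  bijective f /\ {mono f : F G / F <= G}.

Definition automorphisms : set (T -> T) := [set f | automorphism f].

End Posets.

Arguments flags {disp} T.
Arguments automorphisms {disp} T.

Record abstract_polytope (n : nat) := AbstractPolytope {
  face_display : Order.disp_t;
  face :> tbPOrderType face_display;
  rank : face -> int;
  rank_bot : rank \bot = (- 1)%R;
  rank_top : rank \top = n;
  rank_lt : forall F G : face, F < G -> (rank F < rank G)%R;
  rank_cover : forall F G : face,
    F < G -> (forall H : face, ~~ (F < H < G)) -> rank G = (rank F + 1)%R;
  flag_card : forall C : set face, is_flag C -> C #= `I_n.+2;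
  (* rank G - rank F - 1 is the rank of the section G / F; sections of rank at
     most 1 count as connected. *)
  sections_connected : forall F G : face,
    F <= G -> (2 <= rank G - rank F - 1)%R -> section_connected F G;
  diamond : forall F G : face,
    F < G -> rank G = (rank F + 2)%R -> [set H | F < H < G] #= `I_2
}.

(* The face poset of a p-gon: edge j joins the vertices j and j + 1 mod p.
   For p = 2 this is the digon. *)
Inductive polygon (p : nat) : Type :=
  | PEmpty
  | PVertex of 'I_p
  | PEdge of 'I_p
  | PWhole.

Definition polygon_le (p : nat) (x y : polygon p) : bool :=
  match x, y with
  | PEmpty, _ | _, PWhole => true
  | PVertex i, PVertex j => i == j
  | PEdge i, PEdge j => i == j
  | PVertex i, PEdge j => (i == j) || (val i == j.+1 %% p)%N
  | _, _ => false
  end.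

Section Polytopes.
Context {n : nat} (P : abstract_polytope n).

(* An order embedding is injective, so f is an isomorphism of the p-gon onto
   the section G / F. *)
Definition is_polygon_section (F G : P) (p : nat) :=
  exists f : polygon p -> P,
    (forall x y, (f x <= f y) = polygon_le x y) /\ range f = section F G.

(* The tuple (p_1, ..., p_{n-1}) is indexed from 0: p_{i+1} is tnth p i. *)
Definition has_type (p : (n.-1).-tuple nat) :=
  forall (i : 'I_n.-1) (F G : P), F <= G ->
    rank F = (i%:Z - 1)%R -> rank G = (i%:Z + 2)%R ->
    is_polygon_section F G (tnth p i).

Definition tight (p : (n.-1).-tuple nat) :=
  has_type p /\ flags P #= `I_(2 * \prod_(q <- p) q).

Definition regular :=
  forall C D : set P, is_flag C -> is_flag D ->
    exists2 f, automorphism f & f @` C = D.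

Definition adjacent (i : nat) (C D : set P) :=
  [/\ is_flag C, is_flag D, C <> D
    & forall F, rank F <> i -> (C F <-> D F)].

(* rho i is the automorphism moving the base flag C to its i-adjacent flag; the
   values rho i with i >= n are irrelevant. *)
Definition reflections (C : set P) (rho : nat -> P -> P) :=
  forall i, (i < n)%N -> automorphism (rho i) /\ adjacent i C (rho i @` C).

Definition is_function_group (A : set (P -> P)) :=
  [/\ A id, (forall f g, A f -> A g -> A (f \o g))
    & forall f g, A f -> cancel f g -> cancel g f -> A g].

Definition rotations (rho : nat -> P -> P) : set (P -> P) :=
  smallest is_function_group
    [set f | exists2 i, (1 <= i < n)%N & f = rho i.-1 \o rho i].

Definition left_cosets (A B : set (P -> P)) : set (set (P -> P)) :=
  [set [set f \o h | h in B] | f in A].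

Definition orientably_regular :=
  regular /\
  exists (C : set P) (rho : nat -> P -> P),
    [/\ is_flag C, reflections C rho
      & left_cosets (automorphisms P) (rotations rho) #= `I_2].

End Polytopes.

Definition admissible (p : seq nat) :=
  forall i j, (i < size p)%N -> (j < size p)%N -> (j = i.+1 \/ i = j.+1) ->
    odd (nth 0%N p i) ->
    ~~ odd (nth 0%N p j) /\ (nth 0%N p j %| 2 * nth 0%N p i)%N.

(* Main.v *)
(* For a base flag with reflections rho_i, the automorphism group acts freely
   on the flags, so tightness bounds its order by 2 p_1 ... p_(n-1), and the
   rotation subgroup, being proper, has at most p_1 ... p_(n-1) elements. Let
   X_i be the cyclic group generated by sigma_i = rho_(i-1) rho_i. A power of
   sigma_i fixing the base face of rank i-1 or i is trivial, while every other
   sigma_j fixes one of these two faces (the first if j > i, the second if j <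
   i). Hence the product X_1 ... X_(n-1) already has p_1 ... p_(n-1) elements,
   so it is the rotation subgroup, and peeling off the outer factors gives
   <sigma_i, sigma_(i+1)> = X_i X_(i+1).

   Let then G = <x><y> with (xy)^2 = 1, x of odd order p and y of order q. By
   Ito's theorem G' is abelian. Modulo G' we have x^2 = y^(-2), so G = G'<y>
   because p is odd, and m |-> [m, y] maps G' onto itself; it is therefore
   injective, and no nontrivial power of y lies in G'. But y^(2p) lies in G',
   so q divides 2p. If q were odd, G would have odd order and xy would be
   trivial. *)

Require Import Defs.
From mathcomp Require Import all_boot all_order all_algebra.
From mathcomp Require Import all_fingroup commutator cyclic.
From mathcomp Require Import zify.

Set Implicit Arguments.
Unset Strict Implicit.
Unset Printing Implicit Defensive.

Import Order.TTheory.

(** * Products of cyclic groups *)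

Section Products.
Local Open Scope group_scope.
Import GroupScope.
Variable gT : finGroupType.

(** Since [A * B = B * A], one may write [b ^ a1 = a2 * b2] and [a ^ b1 = b3 * a3]; then [a2] and
    [b3] drop out of the commutators and both sides equal [[~ a3, b2]]. *)
Lemma Ito_commutator_conj (A B : {group gT}) a b a1 b1 :
  abelian A -> abelian B -> A * B = A <*> B ->
  a \in A -> b \in B -> a1 \in A -> b1 \in B ->
  [~ a, b] ^ (a1 * b1) = [~ a, b] ^ (b1 * a1).
Proof.
move=> cAA cBB defG aA bB a1A b1B.
have cA u v : u \in A -> v \in A -> [~ u, v] = 1.
  by move=> uA vA; apply/eqP/commgP; apply: (centsP cAA).
have cB u v : u \in B -> v \in B -> [~ u, v] = 1.
  by move=> uB vB; apply/eqP/commgP; apply: (centsP cBB).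
have sA u : u \in A -> u \in A <*> B by apply/subsetP/joing_subl.
have sB u : u \in B -> u \in A <*> B by apply/subsetP/joing_subr.
have: b ^ a1 \in A * B by rewrite defG groupJ ?(sA a1) ?(sB b).
case/mulsgP=> a2 b2 a2A b2B eb.
have: a ^ b1 \in B * A.
  have/comm_group_setP <-: group_set (A * B) by rewrite defG groupP.
  by rewrite defG groupJ ?(sA a) ?(sB b1).
case/mulsgP=> b3 a3 b3B a3A ea.
have aa1 : a ^ a1 = a by apply/conjg_fixP; rewrite cA.
have bb1 : b ^ b1 = b by apply/conjg_fixP; rewrite cB.
have a3a1 : a3 ^ a1 = a3 by apply/conjg_fixP; rewrite cA.
have b2b1 : b2 ^ b1 = b2 by apply/conjg_fixP; rewrite cB.
transitivity [~ a3, b2].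
  rewrite conjgM conjRg aa1 eb commgMJ (cA a a2) // conj1g mulg1 conjRg ea b2b1.
  by rewrite commMgJ (cB b3 b2) // conj1g mul1g.
rewrite conjgM (conjRg a b b1) bb1 ea commMgJ (cB b3 b) // conj1g mul1g.
by rewrite conjRg a3a1 eb commgMJ (cA a3 a2) // conj1g mulg1.
Qed.

(** [A] and [B] commute modulo [[~: A, B]], which therefore contains the derived group. Its
    generators commute: [a1^-1 * b1^-1] and [b1^-1 * a1^-1] conjugate [[~ a, b]] alike, and
    [[~ a1, b1]] is their quotient. *)
Lemma Ito_der1_abelian (A B : {group gT}) :
  abelian A -> abelian B -> A * B = A <*> B -> abelian (A <*> B)^`(1).
Proof.
move=> cAA cBB defG.
have sub : (A <*> B)^`(1) \subset [~: A, B].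
  apply: der1_min; first exact: commg_norm.
  rewrite quotientY ?commg_norml ?commg_normr // abelianY !quotient_abelian //=.
  by rewrite quotient_cents2 ?commg_norml ?commg_normr // commGC.
apply: abelianS sub _.
rewrite /abelian /commutator cent_gen gen_subG.
apply/centsP=> _ /imset2P[a b aA bB ->] _ /imset2P[a1 b1 a1A b1B ->].
apply/commgP/conjg_fixP.
have e := Ito_commutator_conj cAA cBB defG aA bB (groupVr a1A) (groupVr b1B).
have ->: [~ a1, b1] = a1^-1 * b1^-1 * (b1^-1 * a1^-1)^-1.
  by rewrite commgEl conjgE invgM !invgK !mulgA.
by rewrite conjgM e -conjgM mulgV conjg1.
Qed.

(** The map [m |-> [~ m, y]] is an endomorphism of the abelian derived group with kernel the
    centralizer of [y]; once it is onto, finiteness makes it injective. *)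
Lemma der1_cent_supplement (G : {group gT}) y :
  abelian G^`(1) -> y \in G -> G^`(1) * <[y]> = G -> G^`(1) :&: 'C[y] = 1.
Proof.
move=> cMM yG defG; set M := G^`(1)%G; pose f m := [~ m, y].
have nMG : G \subset 'N(M) := der_norm 1 G.
have sMG : M \subset G := der_sub 1 G.
have fM : {in M &, {morph f : u v / u * v}}.
  move=> u v uM vM; rewrite /f commMgJ; congr (_ * _).
  apply/conjg_fixP/commgP/(centsP cMM) => //.
  by rewrite /M /= derg1 mem_commg // (subsetP sMG).
have Ig : group_set (f @: M).
  apply/group_setP; split; first by apply/imsetP; exists 1; rewrite ?group1 /f ?comm1g.
  move=> _ _ /imsetP[u uM ->] /imsetP[v vM ->].
  by apply/imsetP; exists (u * v); rewrite ?groupM ?fM.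
pose I := Group Ig.
have sIM : I \subset M.
  apply/subsetP=> _ /imsetP[u uM ->].
  by rewrite /M /= derg1 mem_commg // (subsetP sMG).
have nIM : M \subset 'N(I) by rewrite cents_norm // (subset_trans cMM) ?centS.
have nIy : <[y]> \subset 'N(I).
  rewrite cycle_subG; apply/normP/eqP; rewrite eqEcard cardJg leqnn andbT.
  apply/subsetP=> _ /imsetP[_ /imsetP[u uM ->] ->].
  rewrite /f conjRg [y ^ y]conjgE mulKg; apply/imsetP; exists (u ^ y) => //.
  by rewrite memJ_norm ?(subsetP nMG).
(* Modulo [I], [y] commutes with [M], so [G / I] is abelian and [I] contains the derived group. *)
have sMI : M \subset I.
  have qG : (M / I) * (<[y]> / I) = G / I by rewrite -quotientMl ?defG.
  apply: der1_min.
    by apply: (@subset_trans _ _ (mem (M * <[y]>))); rewrite ?mul_subG ?defG.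
  rewrite -qG abelianM !quotient_abelian ?cycle_abelian // !andTb.
  rewrite quotient_cents2 // commGC /commutator gen_subG.
  apply/subsetP=> _ /imset2P[u _ uM /cycleP[k ->] ->].
  elim: k => [|k IHk]; first by rewrite commg1 group1.
  rewrite expgSr commgMJ groupM //; first by apply/imsetP; exists u.
  by rewrite memJ_norm // (subsetP nIy) ?cycle_id.
have cardI : #|f @: M| == #|M|.
  by rewrite (_ : f @: M = M) //; apply/eqP; rewrite eqEsubset; apply/andP.
apply/trivgP/subsetP=> m /setIP[mM /cent1P cmy]; rewrite inE.
apply/eqP/(imset_injP cardI) => //.
by rewrite /f comm1g; apply/eqP/commgP.
Qed.

Lemma odd_cycle_product_dvd (x y : gT) :
  <[x]> * <[y]> = <[x]> <*> <[y]> -> (x * y) ^+ 2 = 1 -> odd #[x] ->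
  #[y] %| 2 * #[x].
Proof.
move=> defG xy2 odd_x; set G := (<[x]> <*> <[y]>)%G.
have xG : x \in G by apply: (subsetP (joing_subl _ _)); exact: cycle_id.
have yG : y \in G by apply: (subsetP (joing_subr _ _)); exact: cycle_id.
have cMM : abelian G^`(1).
  exact: (Ito_der1_abelian (cycle_abelian x) (cycle_abelian y) defG).
have nMG : G \subset 'N(G^`(1)) := der_norm 1 G.
have [xN yN] := (subsetP nMG _ xG, subsetP nMG _ yG).
have cq : commute (coset G^`(1) x) (coset G^`(1) y).
  by apply: (centsP (der_abelian 0 G)); rewrite mem_quotient.
have xyq : coset G^`(1) x ^+ 2 * coset G^`(1) y ^+ 2 = 1.
  by rewrite -expgMn // -morphM // -morphX ?groupM // xy2 morph1.
have yM : y ^+ (2 * #[x]) \in G^`(1).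
  apply: coset_idr; first exact: groupX.
  have yq : coset G^`(1) y ^+ 2 = (coset G^`(1) x ^+ 2)^-1.
    by apply/eqP; rewrite eq_sym eq_invg_mul xyq.
  rewrite morphX // expgM yq expVgn -expgM mulnC expgM -morphX //.
  by rewrite expg_order morph1 expg1n invg1.
have/group_setP[_ MyM]: group_set (G^`(1) * <[y]>).
  by apply/comm_group_setP/commute_sym/normC; rewrite (subset_trans _ nMG) ?cycle_subG.
have yMy : <[y]> \subset G^`(1) * <[y]> by rewrite mulG_subr.
have MyX u k : u \in G^`(1) * <[y]> -> u ^+ k \in G^`(1) * <[y]>.
  by move=> Mu; elim: k => [|k IHk]; rewrite ?expgS ?MyM // (subsetP yMy) ?group1.
(* As [x ^+ 2 * y ^+ 2] lies in the derived group, [x ^+ 2] lies in the product; [x] is a power of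
   [x ^+ 2] because its order is odd. *)
have xMy : x \in G^`(1) * <[y]>.
  have -> : x = (x ^+ 2) ^+ (#[x].+1)./2.
    by rewrite -expgM mul2n halfK /= odd_x subn0 expgS expg_order mulg1.
  apply: MyX; rewrite -[_ ^+ 2](mulgK (y ^+ 2)) mem_mulg ?groupV ?mem_cycle //.
  by apply: coset_idr; rewrite ?groupM ?groupX // morphM ?groupX // !morphX.
have Z : G^`(1) :&: 'C[y] = 1.
  apply: der1_cent_supplement => //; apply/eqP; rewrite eqEsubset.
  rewrite mul_subG ?der_sub ?cycle_subG // andTb.
  have sGXY : G \subset <[x]> * <[y]> by rewrite defG.
  apply: subset_trans sGXY _; apply/subsetP=> _ /mulsgP[_ v /cycleP[k ->] yv ->].
  by rewrite MyM ?MyX // (subsetP yMy).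
have: y ^+ (2 * #[x]) \in [1 gT].
  by rewrite -Z inE yM; apply/cent1P/commute_sym/commuteX.
by rewrite order_dvdn inE.
Qed.

Lemma odd_cycle_product_even (x y : gT) :
  <[x]> * <[y]> = <[x]> <*> <[y]> -> <[x]> :&: <[y]> = 1 ->
  (x * y) ^+ 2 = 1 -> odd #[x] -> x != 1 -> ~~ odd #[y].
Proof.
move=> defG tiXY xy2 odd_x; apply: contra => odd_y.
have oddG : odd #|<[x]> <*> <[y]>|.
  by rewrite -defG TI_cardMg // oddM odd_x.
have xyG : x * y \in <[x]> <*> <[y]> by rewrite -defG mem_mulg ?cycle_id.
have /eqP: #[x * y] = 1%N.
  have: #[x * y] %| 2 by rewrite order_dvdn xy2.
  rewrite dvdn_divisors // !inE => /orP[/eqP->//|/eqP o2].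
  by have := dvdn_odd (order_dvdG xyG) oddG; rewrite o2.
rewrite order_eq1 => /eqP xy1; have: x \in [1 gT]; last by rewrite inE.
rewrite -tiXY inE cycle_id.
by rewrite -(mulgK y x) xy1 mul1g groupV cycle_id.
Qed.

(** [B] is only a set, since a partial product of cyclic groups need not be a subgroup; enclosing it
    in [K] makes the factorization unique. *)
Lemma card_mulg_TI (A K : {group gT}) (B : {set gT}) :
  B \subset K -> A :&: K = 1 -> #|A * B| = (#|A| * #|B|)%N.
Proof.
move=> sBK tiAK; rewrite -cardsX [A * B]curry_imset2X card_in_imset //.
move=> [a b] [a1 b1] /setXP[/= aA bB] /setXP[/= a1A b1B] eab.
have bK := subsetP sBK; have: a1^-1 * a \in A :&: K.
  rewrite inE groupM ?groupV //=.
  have ->: a1^-1 * a = b1 * b^-1.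
    by apply: (mulgI a1); rewrite mulKVg mulgA -[a1 * b1]eab mulgK.
  by rewrite groupM ?groupV ?bK.
rewrite tiAK inE -eq_mulVg1 => /eqP e; congr (_, _) => //.
by apply: (mulgI a); rewrite [a * b]eab e.
Qed.

(* [S j] plays the role of the stabilizer of the base face of rank [j]: it
   detects the factor [j] from the left and the factor [j - 1] from the right. *)
Section CyclicFactors.
Variables (m : nat) (x : nat -> gT) (S : nat -> {group gT}) (Gp : {group gT}).
Hypothesis xG : forall i, (i < m)%N -> x i \in Gp.
Hypothesis xS : forall i j, (i < m)%N -> (j <= m)%N -> j != i -> j != i.+1 ->
  x i \in S j.
Hypothesis tiS : forall i, (i < m)%N -> <[x i]> :&: S i = 1.
Hypothesis tiS1 : forall i, (i < m)%N -> <[x i]> :&: S i.+1 = 1.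

Let Q i j := \prod_(i <= k < j) <[x k]>.

Lemma cycle_prod_sub (K : {group gT}) i j :
  (forall k, (i <= k < j)%N -> x k \in K) -> Q i j \subset K.
Proof.
move=> xK; rewrite /Q big_nat_cond.
elim/big_ind: _ => [|A B sA sB|k]; [exact: sub1G | by rewrite mul_subG |].
by rewrite andbT => /xK; rewrite cycle_subG.
Qed.

(** The later generators lie in [S i], hence so does the tail of [h]; the leading factor then lies
    in [<[x i]> :&: S i] and vanishes. *)
Lemma mem_cycle_prod_left i h : (i < m)%N ->
  h \in S i -> h \in Q i m -> h \in Q i.+1 m.
Proof.
move=> lt_im hS; rewrite /Q big_ltn // => /mulsgP[a q ax qQ eh].
suff a1 : a = 1 by rewrite eh a1 mul1g.
have qS : q \in S i.
  apply: subsetP qQ; apply: cycle_prod_sub => k /andP[lt_ik lt_km].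
  by apply: xS; lia.
have: a \in <[x i]> :&: S i by rewrite inE ax -(mulgK q a) -eh groupM ?groupV.
by rewrite tiS // inE => /eqP.
Qed.

Lemma mem_cycle_prod_right i j h : (i <= j < m)%N ->
  h \in S j.+1 -> h \in Q i j.+1 -> h \in Q i j.
Proof.
case/andP=> le_ij lt_jm hS; rewrite /Q big_nat_recr //= => /mulsgP[q a qQ ax eh].
suff a1 : a = 1 by rewrite eh a1 mulg1.
have qS : q \in S j.+1.
  apply: subsetP qQ; apply: cycle_prod_sub => k /andP[_ lt_kj].
  by apply: xS; lia.
have: a \in <[x j]> :&: S j.+1 by rewrite inE ax -(mulKg q a) -eh groupM ?groupV.
by rewrite tiS1 // inE => /eqP.
Qed.

Lemma card_cycle_prod i : (i <= m)%N -> #|Q i m| = (\prod_(i <= k < m) #[x k])%N.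
Proof.
move=> le_im; rewrite -(subKn le_im).
have : (m - i <= m)%N by rewrite leq_subr.
elim: (m - i)%N => [|d IHd] le_dm; first by rewrite subn0 /Q !big_geq ?cards1.
have lt_km : (m - d.+1 < m)%N by lia.
rewrite /Q !(big_ltn lt_km) subnSK // -IHd ?(ltnW le_dm) //.
apply: card_mulg_TI (tiS lt_km); apply: cycle_prod_sub => k /andP[lt_k lt_m].
by apply: xS; lia.
Qed.

Lemma consecutive_cycles_TI i : (i.+1 < m)%N -> <[x i]> :&: <[x i.+1]> = 1.
Proof.
move=> lt_im; apply/trivgP; rewrite -(tiS (ltnW lt_im)) setIS // cycle_subG.
by rewrite xS //; lia.
Qed.

Hypothesis leG : (#|Gp| <= \prod_(i < m) #[x i])%N.

(** The product is a subset of [Gp] with as many elements as the bound [leG] allows. *)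
Lemma cycle_prodE : Q 0 m = Gp.
Proof.
apply/eqP; rewrite eqEcard cycle_prod_sub //=.
by rewrite card_cycle_prod // big_mkord.
Qed.

(** An element of the join lies in the full product and in every [S j] with [j] outside [i], [i.+1],
    [i.+2]; it thus loses first the factors below [i], then those above [i.+1]. *)
Lemma joing_consecutive_cycles i : (i.+1 < m)%N ->
  <[x i]> * <[x i.+1]> = <[x i]> <*> <[x i.+1]>.
Proof.
move=> lt_im; apply/eqP; rewrite eqEsubset mulG_subG joing_subl joing_subr /=.
apply/subsetP=> h hH.
have HS j : (j <= m)%N -> j \notin [:: i; i.+1; i.+2] -> h \in S j.
  rewrite !inE !negb_or => le_jm /and3P[ji ji1 ji2]; apply: subsetP hH.
  by rewrite join_subG !cycle_subG !xS //; lia.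
have left k : (k <= i)%N -> h \in Q k m.
  elim: k => [_|k IHk lt_ki].
    rewrite cycle_prodE; apply: subsetP hH.
    by rewrite join_subG !cycle_subG !xG // ltnW.
  apply: mem_cycle_prod_left (IHk (ltnW lt_ki)); first by lia.
  by apply: HS; rewrite ?inE; lia.
(* [d] counts the factors removed on the right; two remain at [d = m - i.+2]. *)
have right d : (d <= m - i.+2)%N -> h \in Q i (m - d).
  elim: d => [|d IHd] le_d; first by rewrite subn0 left.
  have kS : (m - d.+1).+1 = (m - d)%N by lia.
  apply: mem_cycle_prod_right; first by lia.
    by apply: HS; rewrite ?inE; lia.
  by rewrite kS IHd // ltnW.
have := right _ (leqnn _); rewrite subKn //.
by rewrite /Q big_ltn // big_nat1.
Qed.

End CyclicFactors.
End Products.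

(* Imported only here because classical_sets shadows [subsetP] and [setIC]. *)
From mathcomp Require Import boolp classical_sets functions cardinality.
Local Open Scope classical_set_scope.
Local Open Scope card_scope.
Local Open Scope order_scope.

(** * Faces and automorphisms of a polytope *)

Section Faces.
Context {n : nat} (P : abstract_polytope n).
Implicit Types (F G H K L : P) (f : P -> P).

Lemma rank_le F G : F <= G -> (rank F <= rank G)%R.
Proof. by rewrite le_eqVlt => /predU1P[->|/rank_lt/ltW]. Qed.

Lemma le_rank_eq F G : F <= G -> (rank G <= rank F)%R -> F = G.
Proof. by rewrite le_eqVlt => /predU1P[//|/rank_lt]; lia. Qed.

Lemma exists_cover F G : F < G ->
  exists2 H, F < H <= G & rank H = (rank F + 1)%R.
Proof.
have [d] : exists d : nat, (rank G - rank F <= d%:Z)%R by exists `|rank G - rank F|%N; lia.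
elim: d G => [|d IHd] G le_d ltFG; first by have := rank_lt ltFG; lia.
have [[H /andP[FH HG]]|noH] := pselect (exists H, F < H < G).
  have [|K /andP[FK KH] rK] := IHd H _ FH; first by have := rank_lt HG; lia.
  by exists K; rewrite // FK (le_trans KH (ltW HG)).
exists G; rewrite ?ltFG ?lexx //; apply: rank_cover => // H.
by apply/negP => FHG; apply: noH; exists H.
Qed.

Lemma diamond_pigeonhole F G H1 H2 H3 : rank G = (rank F + 2)%R ->
  F < H1 < G -> F < H2 < G -> F < H3 < G -> [\/ H1 = H2, H1 = H3 | H2 = H3].
Proof.
move=> rG h1 h2 h3; have ltFG : F < G by case/andP: h1 => /lt_trans h /h.
have /card_set_bijP[g [gI gJ _]] := diamond ltFG rG.
have := (gI _ h1, gI _ h2, gI _ h3) => -[[/= g1 g2] g3].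
have gE K1 K2 : F < K1 < G -> F < K2 < G -> g K1 = g K2 -> K1 = K2.
  by move=> k1 k2; apply: gJ; apply/mem_set.
have : [\/ g H1 = g H2, g H1 = g H3 | g H2 = g H3].
  have [|]: g H1 = g H2 \/ (g H1 = g H3 \/ g H2 = g H3) by lia.
    by constructor 1.
  by case; [constructor 2 | constructor 3].
by case=> /gE e; [constructor 1 | constructor 2 | constructor 3]; apply: e.
Qed.

Lemma aut_lt f F G : automorphism f -> (f F < f G) = (F < G).
Proof. by case=> _ fM; rewrite !lt_neqAle fM (inj_eq (inc_inj fM)). Qed.

Lemma aut_inj f : automorphism f -> injective f.
Proof. by case=> /bij_inj. Qed.

Lemma aut_comp f f' : automorphism f -> automorphism f' -> automorphism (f \o f').
Proof.
move=> [fB fM] [f'B f'M]; split; first exact: bij_comp.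
by move=> F G /=; rewrite fM f'M.
Qed.

Lemma aut_bot f : automorphism f -> f \bot = \bot.
Proof.
case=> -[g gK fK] fM; apply: le_anti; rewrite le0x andbT.
by rewrite -[X in _ <= X]fK fM le0x.
Qed.

Lemma aut_top f : automorphism f -> f \top = \top.
Proof.
case=> -[g gK fK] fM; apply: le_anti; rewrite lex1 /=.
by rewrite -[X in X <= _]fK fM lex1.
Qed.

(** Along covers ranks rise by one and their images by at least one, so [f] never shrinks a rank
    gap; this is applied below and above [F], both extreme faces being fixed. *)
Lemma aut_rank f F : automorphism f -> rank (f F) = rank F.
Proof.
move=> fA; have expand G H : G <= H -> (rank H - rank G <= rank (f H) - rank (f G))%R.
  have [d] : exists d : nat, (rank H - rank G <= d%:Z)%R by exists `|rank H - rank G|%N; lia.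
  elim: d G => [|d IHd] G le_d; rewrite le_eqVlt => /predU1P[->|ltGH]; try by rewrite !GRing.subrr.
    by have := rank_lt ltGH; lia.
  have [K /andP[GK KH] rK] := exists_cover ltGH.
  have := IHd K _ KH; have : (rank (f G) < rank (f K))%R by apply: rank_lt; rewrite aut_lt.
  by lia.
have := expand \bot F (le0x _); have := expand F \top (lex1 _).
by rewrite aut_bot // aut_top //; lia.
Qed.

(** Ranks rise one at a time, so this is a maximal chain of the section [G / F]. *)
Inductive fixed_chain f : P -> P -> Prop :=
  | FixedNil F : f F = F -> fixed_chain f F F
  | FixedCons F H G : f F = F -> F < H -> rank H = (rank F + 1)%R ->
      fixed_chain f H G -> fixed_chain f F G.

Lemma fixed_chain_cat f F G H :
  fixed_chain f F G -> fixed_chain f G H -> fixed_chain f F H.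
Proof.
elim=> [//|F1 K G1 fF FK rK _ IH GH].
by apply: FixedCons (IH GH).
Qed.

Lemma fixed_chain_le f F G : fixed_chain f F G -> F <= G.
Proof. by elim=> [F0 _|F0 H G0 _ /ltW FH _ _ HG]; [exact: lexx | exact: le_trans HG]. Qed.

Lemma fixed_chain_ends f F G : fixed_chain f F G -> f F = F /\ f G = G.
Proof. by elim=> // F0 H G0 fF _ _ _ [_ fG]. Qed.

Lemma fixed_section_chain f F G : F <= G ->
  (forall H, F <= H <= G -> f H = H) -> fixed_chain f F G.
Proof.
have [d] : exists d : nat, (rank G - rank F <= d%:Z)%R by exists `|rank G - rank F|%N; lia.
elim: d F => [|d IHd] F le_d; rewrite le_eqVlt => /predU1P[->|ltFG] fH;
  try by apply: FixedNil; apply: fH; rewrite !lexx.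
  by have := rank_lt ltFG; lia.
have [K /andP[FK KG] rK] := exists_cover ltFG.
apply: (FixedCons _ FK rK); first by rewrite fH // lexx ltW.
apply: IHd => //; first by lia.
by move=> H /andP[KH HG]; rewrite fH // HG (ltW (lt_le_trans FK KH)).
Qed.

(* Along a path of incident faces, the property of lying on a fixed chain from
   [F] to [G] propagates, since the sections below and above each face are
   smaller. *)
Lemma fixed_chain_section f F G H : automorphism f ->
  fixed_chain f F G -> F <= H <= G -> f H = H.
Proof.
move=> fA; have [d] : exists d : nat, (rank G - rank F <= d%:Z)%R.
  by exists `|rank G - rank F|%N; lia.
elim: d F G H => [|d IHd] F G H le_d fFG.
  have FG := le_rank_eq (fixed_chain_le fFG) _.
  by rewrite FG -?eq_le; [move=> /eqP <-; case: (fixed_chain_ends fFG) | lia].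
have [fF fG] := fixed_chain_ends fFG.
case/andP; rewrite !le_eqVlt => /predU1P[<- //|FH] /predU1P[-> //|HG].
case: fFG le_d fF fG FH HG => {F G} [F _|F K G _ FK rK fKG] le_d fF fG FH HG.
  by have := lt_trans FH HG; rewrite ltxx.
have [fK _] := fixed_chain_ends fKG.
have := fixed_chain_le fKG; rewrite le_eqVlt => /predU1P[eKG|KG].
  by have := rank_lt FH; have := rank_lt HG; rewrite -eKG; lia.
have [r2|r3] : rank G = (rank F + 2)%R \/ (2 <= rank G - rank F - 1)%R.
  by have := rank_lt KG; lia.
  (* The section has two proper faces, one of them the fixed face [K], so [H] and [f H] cannot
     differ. *)
  have fHb : F < f H < G by rewrite -{1}fF -{1}fG !aut_lt // FH HG.
  have [| | |e|e|] := diamond_pigeonhole (H1 := K) (H2 := H) (H3 := f H) r2;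
    rewrite ?FK ?KG ?FH ?HG ?fHb //.
  - by rewrite -e.
  - by apply: (aut_inj fA); rewrite -e.
have [|||s [sA sP <-]] := sections_connected _ r3 (H := K) (K := H);
  rewrite ?FK ?KG ?FH ?HG ?(ltW (lt_trans FK KG)) //.
have fFK : fixed_chain f F K by apply: FixedCons (FixedNil fK).
move: {H FH HG rK fK} K FK KG fKG fFK sA sP.
elim: s => [|M s IHs] K FK KG fKG fFK /=; first by move=> _ _; case: (fixed_chain_ends fFK).
case/andP=> /andP[FM MG] sA /andP[KM sP].
have {}IHs := IHs M FM MG _ _ sA sP.
have below L : F < L -> L < G -> fixed_chain f F L -> forall N, F <= N <= L -> f N = N.
  by move=> FL LG fFL N; apply: (IHd F L N _ fFL); have := rank_lt LG; lia.
have above L : F < L -> L < G -> fixed_chain f L G -> forall N, L <= N <= G -> f N = N.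
  by move=> FL LG fLG N; apply: (IHd L G N _ fLG); have := rank_lt FL; lia.
have {}below := below K FK KG fFK; have {}above := above K FK KG fKG.
(* [M] lies in a section already fixed pointwise, [G / K] or [K / F]. Chains ending at [M] are cut
   out of it, and one is joined at [K] to the old chain on the other side. *)
have [leKM|leMK] := orP KM; apply: IHs.
- apply: fixed_section_chain (ltW MG) _ => N /andP[MN NG].
  by apply: above; rewrite NG (le_trans leKM).
- apply: fixed_chain_cat fFK (fixed_section_chain leKM _) => N /andP[KN NM].
  by apply: above; rewrite KN (le_trans NM (ltW MG)).
- apply: fixed_chain_cat (fixed_section_chain leMK _) fKG => N /andP[MN NK].
  by apply: below; rewrite NK (le_trans (ltW FM) MN).
- apply: fixed_section_chain (ltW FM) _ => N /andP[FN NM].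
  by apply: below; rewrite FN (le_trans NM leMK).
Qed.

Lemma aut_diamond_sq f F G H : automorphism f -> rank G = (rank F + 2)%R ->
  f F = F -> f G = G -> F < H < G -> f (f H) = H.
Proof.
move=> fA r2 fF fG FHG.
have fb K : F < K < G -> F < f K < G by rewrite -{2}fF -{2}fG !aut_lt.
have [e|e|/(aut_inj fA) e] := diamond_pigeonhole r2 FHG (fb _ FHG) (fb _ (fb _ FHG)).
- by rewrite -!e.
- by [].
- by rewrite -!e.
Qed.

End Faces.

(** * Base flags and the rigidity of automorphisms *)

Section BaseFlag.
Context {n : nat} (P : abstract_polytope n).
Implicit Types (F G H K L : P) (f : P -> P).

(* [b j] has rank [j - 1], so that [b 0] is the least face. *)
Lemma flag_faces (C : set P) : is_flag C -> exists b : nat -> P,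
  [/\ forall j, (j <= n.+1)%N -> C (b j),
      forall j, (j <= n.+1)%N -> rank (b j) = (j%:Z - 1)%R
    & forall F, C F -> exists2 j, (j <= n.+1)%N & F = b j].
Proof.
move=> flC; have [chC _] := flC.
have /card_set_bijP[g [_ _ gS]] := flag_card flC.
have /choice[h hP] : forall k : 'I_n.+2, exists F, C F /\ g F = k.
  by move=> k; have [F CF gF] := gS k (ltn_ord k); exists F.
have rb F : (0 <= rank F + 1 <= n%:Z + 1)%R.
  have := rank_le (le0x F); have := rank_le (lex1 F).
  by rewrite (rank_bot P) (rank_top P); lia.
have rI F G : C F -> C G -> rank F = rank G -> F = G.
  move=> CF CG rFG; case: (chC F G CF CG) => le_; first by apply: le_rank_eq; rewrite ?rFG.
  by apply/esym/le_rank_eq; rewrite ?rFG.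
(* Faces of a chain with equal ranks coincide, so this shifted rank is injective, hence bijective;
   its inverse finds the face of each rank. *)
pose r (k : 'I_n.+2) : 'I_n.+2 := inord `|(rank (h k) + 1)%R|%N.
have rE k : ((r k)%:Z = rank (h k) + 1)%R.
  by have hk := rb (h k); rewrite inordK; lia.
have r_inj : injective r.
  move=> k l e; have [[Ck gk] [Cl gl]] := (hP k, hP l).
  apply: ord_inj; rewrite -gk -gl; congr g.
  by apply: rI => //; have := rE k; have := rE l; rewrite e; lia.
have [s sK Ks] := injF_bij r_inj.
have bC j : (j <= n.+1)%N -> C (h (s (inord j))) by case: (hP (s (inord j))).
have br j : (j <= n.+1)%N -> rank (h (s (inord j))) = (j%:Z - 1)%R.
  by move=> le_j; have := rE (s (inord j)); rewrite Ks inordK //; lia.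
exists (fun j => h (s (inord j))); split=> // F CF.
have rF := rb F; exists `|(rank F + 1)%R|%N; first by lia.
have le_r : (`|(rank F + 1)%R| <= n.+1)%N by lia.
apply: rI => //; first exact: bC.
by rewrite br //; lia.
Qed.

Lemma flag_faces_lt (C : set P) (b : nat -> P) : is_flag C ->
  (forall j, (j <= n.+1)%N -> C (b j)) ->
  (forall j, (j <= n.+1)%N -> rank (b j) = (j%:Z - 1)%R) ->
  forall j k, (j < k <= n.+1)%N -> b j < b k.
Proof.
move=> [chC _] bC br j k /andP[lt_jk le_k].
have le_j : (j <= n.+1)%N by lia.
have ne : b j != b k by apply/eqP => e; have := br j le_j; rewrite e br //; lia.
rewrite lt_neqAle ne; case: (chC _ _ (bC j le_j) (bC k le_k)) => // /rank_le.
by rewrite !br //; lia.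
Qed.

(** The flag is a fixed chain from the least to the greatest face, whose section is the whole
    poset. *)
Lemma aut_fix_flag (b : nat -> P) f :
  (forall j, (j <= n.+1)%N -> rank (b j) = (j%:Z - 1)%R) ->
  (forall j k, (j < k <= n.+1)%N -> b j < b k) ->
  automorphism f -> (forall j, (j <= n.+1)%N -> f (b j) = b j) -> f = id.
Proof.
move=> br bl fA fb; apply/funext => H; have rb := (rank_bot P, rank_top P).
have b0 : \bot = b 0%N by apply: le_rank_eq; rewrite ?le0x // rb br //; lia.
have b1 : b n.+1 = \top by apply: le_rank_eq; rewrite ?lex1 // rb br //; lia.
have ch d : (d <= n.+1)%N -> fixed_chain f (b (n.+1 - d)%N) (b n.+1).
  elim: d => [|d IHd] le_d; first by rewrite subn0; apply: FixedNil; apply: fb.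
  apply: FixedCons (IHd (ltnW le_d)); first by apply: fb; lia.
    by apply: bl; lia.
  by rewrite !br; lia.
apply: (fixed_chain_section fA (ch _ (leqnn _))).
by rewrite subnn -b0 b1 le0x lex1.
Qed.

(** A flag face whose two neighbours in the flag are fixed returns after two steps, by the diamond
    condition, so [f \o f] fixes the flag. This serves for a reflection and for a product
    [rho i \o rho i.+2]. *)
Lemma aut_sq_id (b : nat -> P) f :
  (forall j, (j <= n.+1)%N -> rank (b j) = (j%:Z - 1)%R) ->
  (forall j k, (j < k <= n.+1)%N -> b j < b k) ->
  automorphism f -> f (b 0%N) = b 0%N -> f (b n.+1) = b n.+1 ->
  (forall j, (j < n)%N ->
    f (b j.+1) = b j.+1 \/ f (b j) = b j /\ f (b j.+2) = b j.+2) ->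
  f \o f = id.
Proof.
move=> br bl fA f0 fn1 fb.
apply: (aut_fix_flag br bl (aut_comp fA fA)) => -[|j] le_j /=; first by rewrite !f0.
have [->|lt_j] : j = n \/ (j < n)%N by lia.
  by rewrite !fn1.
have [e|[e1 e2]] := fb j lt_j; first by rewrite !e.
apply: (aut_diamond_sq fA _ e1 e2); last by rewrite !bl; lia.
by rewrite !br; lia.
Qed.

End BaseFlag.

(** * Rotations of a polygonal section *)

Section PolygonWalk.
Context {n : nat} (P : abstract_polytope n).
Implicit Types (F G H K L v e : P) (f : P -> P) (p : nat) (c : nat -> P).

(* [c] lists vertices and edges alternately, hence the period [2 * p]; the
   predecessor of [c m] is written [c (m + (2 * p).-1)]. *)
Definition polygon_walk F G p c :=
  [/\ forall a b, c a = c b <-> a = b %[mod 2 * p],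
      forall m, F < c m < G,
      forall m, c m >=< c m.+1
    & forall m K, F < K < G -> K >=< c m ->
        [\/ K = c m, K = c m.+1 | K = c (m + (2 * p).-1)%N]].

Lemma modn_double p m : (m %% (2 * p) = odd m + 2 * (m./2 %% p))%N.
Proof.
case: p => [|p]; first by rewrite muln0 !modn0; lia.
rewrite -{1}(odd_double_half m) -mul2n {1}(divn_eq m./2 p.+1) mulnDr mulnA.
rewrite (mulnC 2 (_ %/ _)) -mulnA addnCA modnMDl modn_small //.
by have := ltn_pmod m./2 (ltn0Sn p); case: (odd m); lia.
Qed.

Lemma polygon_section_walk F G p : (0 < p)%N -> is_polygon_section F G p ->
  exists c, polygon_walk F G p c /\ forall K, F < K < G -> exists t, K = c t.
Proof.
case: p => // p _ [f [fle frange]].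
have fsec x : F <= f x <= G by have: section F G (f x) by rewrite -frange; exists x.
have f_inj : injective f.
  move=> x y exy; have := fle x y; have := fle y x; rewrite exy lexx.
  case: x {exy} => [|i|i|]; case: y => [|j|j|] //=; try by move=> _ /esym/eqP->.
have fE K : F <= K <= G -> exists x, K = f x.
  by move=> FKG; have: section F G K by []; rewrite -frange => -[x _ <-]; exists x.
have leFG : F <= G by have /andP[/le_trans h /h] := fsec (PEmpty p.+1).
have fF : f (PEmpty _) = F.
  apply: le_anti; have /andP[-> _] := fsec (PEmpty p.+1); rewrite andbT.
  by have [|x ex] := fE F; rewrite ?lexx // [X in _ <= X]ex fle.
have fG : f (PWhole _) = G.
  apply: le_anti; have /andP[_ ->] := fsec (PWhole p.+1); rewrite andTb.
  by have [|x ex] := fE G; rewrite ?lexx ?leFG // [X in X <= _]ex fle; case: (x).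
have ltFG x : x <> PEmpty p.+1 -> x <> PWhole p.+1 -> F < f x < G.
  move=> x0 x1; have /andP[Fx xG] := fsec x; rewrite !lt_neqAle Fx xG !andbT.
  by apply/andP; split; apply/eqP; rewrite -?fF -?fG => /f_inj // /esym.
(* The walk is vertex 0, edge 0, vertex 1, edge 1, and so on, as edge [j] joins vertices [j] and
   [j + 1]. *)
pose q m : 'I_p.+1 := Ordinal (ltn_pmod m./2 (ltn0Sn p)).
pose w m := if odd m then PEdge (q m) else PVertex (q m).
have wE a b : w a = w b <-> a = b %[mod 2 * p.+1].
  rewrite !modn_double /w; split.
    by case: (odd a) (odd b) => -[] // [->].
  move=> e; have [-> eq_q] : odd a = odd b /\ (a./2 %% p.+1 = b./2 %% p.+1)%N.
    by move: e; case: (odd a) (odd b) => -[]; lia.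
  by have -> : q a = q b by apply: val_inj.
have wS x : x <> PEmpty p.+1 -> x <> PWhole p.+1 -> exists t, x = w t.
  case: x => // i _ _.
    exists (i.*2)%N; rewrite /w odd_double; congr PVertex; apply: val_inj.
    by rewrite /= doubleK modn_small.
  exists (i.*2.+1)%N; rewrite /w /= odd_double; congr PEdge; apply: val_inj.
  by rewrite /= uphalf_double modn_small.
exists (fun m => f (w m)); split; last first.
  move=> K /andP[FK KG]; have [|x eK] := fE K; first by rewrite !ltW.
  have [||t ext] := wS x; last by exists t; rewrite -ext.
    by move=> ex; move: FK; rewrite eK ex fF ltxx.
  by move=> ex; move: KG; rewrite eK ex fG ltxx.
split.
- move=> a b; rewrite -wE; split=> [/f_inj//|-> //].
- by move=> m; apply: ltFG; rewrite /w; case: ifP.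
- move=> m; rewrite /Order.comparable !fle /w /=.
  case: (boolP (odd m)) => /= [om|em].
    have e : (uphalf m %% p.+1 = (m./2 %% p.+1).+1 %% p.+1)%N.
      by rewrite uphalf_half om -[(_ %% _).+1]addn1 modnDml addnC.
    by rewrite e eqxx !orbT.
  by rewrite -val_eqE /= uphalf_half (negbTE em) eqxx.
move=> m K /andP[FK KG]; have [|x eK] := fE K; first by rewrite !ltW.
have [||t ext] := wS x.
- by move=> ex; move: FK; rewrite eK ex fF ltxx.
- by move=> ex; move: KG; rewrite eK ex fG ltxx.
rewrite {}eK {}ext /Order.comparable !fle => tm.
suff: [\/ w t = w m, w t = w m.+1 | w t = w (m + (2 * p.+1).-1)%N].
  by case=> ->; [constructor 1 | constructor 2 | constructor 3].
have odd_s : odd (m + (2 * p.+1).-1) = ~~ odd m by lia.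
have odd_m1 : odd m.+1 = ~~ odd m by [].
move: tm; rewrite /w odd_s odd_m1.
case: (boolP (odd t)) => ot; case: (boolP (odd m)) => om /=; rewrite ?orbF -?val_eqE /=.
- by case/orP=> /eqP e; constructor 1; congr PEdge; apply: val_inj.
- have hm : uphalf m = m./2 by lia.
  case/orP=> /eqP e; [constructor 2 | constructor 3]; congr PEdge; apply: val_inj => /=.
    by rewrite hm e.
  have -> : (m + (2 * p.+1).-1)./2 = (m./2 + p)%N by lia.
  by rewrite -modnDml e modnDml addSn -addnS modnDr modn_mod.
- case/orP=> /eqP e; [constructor 3 | constructor 2]; congr PVertex; apply: val_inj => /=.
    have -> : (m + (2 * p.+1).-1)./2 = (m./2 + p.+1)%N by lia.
    by rewrite modnDr.
  by rewrite e uphalf_half om -addn1 modnDml addnC.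
by case/orP=> /eqP e; constructor 1; congr PVertex; apply: val_inj.
Qed.

(** A given walk is shifted to start at [v], and reversed if [e] is the predecessor of [v]. *)
Lemma polygon_walk_from F G p v e : (0 < p)%N -> is_polygon_section F G p ->
  F < v < G -> F < e < G -> v >=< e -> v <> e ->
  exists c, [/\ polygon_walk F G p c, c 0%N = v & c 1%N = e].
Proof.
move=> p0 /(polygon_section_walk p0)[c [[cE cFG cS cN] cK]] vFG eFG cve ne.
have [s ev] := cK v vFG.
have E a b : a = b %[mod 2 * p] -> c a = c b by move/cE.
(* [k.+1] is -1 modulo [2 * p], so multiplying indices by it reverses the walk without
   subtraction. *)
have [k ek] : exists k, (2 * p = k.+2)%N by exists (2 * p).-2; lia.
rewrite /polygon_walk ek in cE cN *; have {}E a b : a = b %[mod k.+2] -> c a = c b by move/cE.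
have u2 m : (k.+1 * (k.+1 * m) = m %[mod k.+2])%N.
  have -> : (k.+1 * (k.+1 * m) = k * m * k.+2 + m)%N by nia.
  by rewrite modnMDl.
have [||ee|ee] := cN s e eFG; first by rewrite -ev comparable_sym.
- by rewrite -ev => e_v; case: ne.
- exists (fun m => c (s + m)%N); split; rewrite ?addn0 ?addn1 //; split=> //.
  + move=> a b; rewrite cE; split=> ab; apply/eqP; last by rewrite eqn_modDl; apply/eqP.
    by rewrite -(eqn_modDl s); apply/eqP.
  + by move=> m; rewrite addnS.
  + by move=> m K FKG /(cN _ _ FKG); rewrite addnS addnA.
exists (fun m => c (s + k.+1 * m)%N).
have S1 m : c (s + k.+1 * m)%N = c (s + k.+1 * m.+1).+1.
  apply: E; have -> : ((s + k.+1 * m.+1).+1 = s + k.+1 * m + k.+2)%N by nia.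
  by rewrite modnDr.
have S2 m : c (s + k.+1 * m.+1)%N = c (s + k.+1 * m + k.+1)%N by rewrite mulnS addnCA addnC.
have S3 m : c (s + k.+1 * m).+1 = c (s + k.+1 * (m + k.+1))%N.
  apply: E; have -> : (s + k.+1 * (m + k.+1) = k * k.+2 + (s + k.+1 * m).+1)%N by nia.
  by rewrite modnMDl.
split; rewrite ?muln0 ?muln1 ?addn0 //; split=> //.
- move=> a b; rewrite cE; split=> [/eqP|ab].
    rewrite eqn_modDl => /eqP e_ab.
    by rewrite -(u2 a) -(u2 b) -modnMmr e_ab modnMmr.
  by apply/eqP; rewrite eqn_modDl -modnMmr ab modnMmr.
- by move=> m; rewrite [X in X >=< _]S1 comparable_sym.
- move=> m K FKG /(cN _ _ FKG) []; rewrite ?S3 -?S2; [constructor 1|constructor 3|constructor 2] => //.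
Qed.

(** [r0] reflects the walk in [c 1] and [r1] reflects it in [c 0], so their composite shifts it by
    two. For [p = 1], [c 2 = c 0] would make [r0] fix [c 0]. *)
Lemma rotation_walk F G p c r0 r1 : polygon_walk F G p c -> (0 < p)%N ->
  automorphism r0 -> automorphism r1 ->
  r0 F = F -> r0 G = G -> r1 F = F -> r1 G = G ->
  r0 (c 1%N) = c 1%N -> r0 (c 0%N) <> c 0%N ->
  r1 (c 0%N) = c 0%N -> r1 (c 1%N) <> c 1%N ->
  (1 < p)%N /\ forall m, r0 (r1 (c m)) = c m.+2.
Proof.
move=> [cE cFG cS cN] p0 a0 a1 r0F r0G r1F r1G r01 r00 r10 r11.
have E a b : a = b %[mod 2 * p] -> c a = c b by move/cE.
have perE m : c (m + 2 * p)%N = c m by apply: E; rewrite modnDr.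
have neD m d : (0 < d < 2 * p)%N -> c m <> c (m + d)%N.
  move=> /andP[d0 dp] /cE e; have: (m + 0 == m + d %[mod 2 * p])%N by rewrite addn0; apply/eqP.
  by rewrite eqn_modDl !modn_small //; lia.
have ne1 m : c m <> c m.+1 by rewrite -addn1; apply: neD; lia.
have nbr f k l m : automorphism f -> f F = F -> f G = G -> f (c k) = c m ->
    c l >=< c k -> c l <> c k -> f (c l) = c m.+1 \/ f (c l) = c (m + (2 * p).-1)%N.
  move=> fA fF fG fk lk ne_lk.
  have [||h|h|h] := cN m (f (c l)); [ | | | by left | by right].
  - by rewrite -{1}fF -{1}fG !aut_lt.
  - by rewrite -fk /Order.comparable !(proj2 fA).
  - by case: ne_lk; apply: (aut_inj fA); rewrite h.
have back m : (m.+1 + (2 * p).-1 = m + 2 * p)%N by lia.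
have e00 : r0 (c 0%N) = c 2%N.
  have [||||||h|h] := nbr r0 1%N 0%N 1%N => //.
  by case: r00; rewrite h back perE.
have p1 : (1 < p)%N.
  rewrite ltn_neqAle p0 andbT; apply/eqP => p1; apply: r00; rewrite e00.
  by apply: E; rewrite -p1.
split=> //.
have e11 : r1 (c 1%N) = c (2 * p).-1.
  have [||||||h|h] := nbr r1 0%N 1%N 0%N => //; first by rewrite comparable_sym.
  by move=> e; apply: (ne1 0%N).
have cp : c (2 * p).-1 >=< c 0%N.
  by rewrite -(perE 0%N) add0n -[X in _ >=< c X]prednK ?cS //; lia.
have cpn : c (2 * p).-1 <> c 0%N by rewrite -(perE 0%N) add0n -[X in _ <> c X]prednK //; lia.
have e1p : r1 (c (2 * p).-1) = c 1%N.
  have [||||||//|] := nbr r1 0%N (2 * p).-1 0%N => //.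
  by rewrite add0n -e11 => /(aut_inj a1).
(* Index [(2 * p).-1] stands for -1. The shift is known at -1 and 0; from there each new image is a
   neighbour of the last one, and injectivity excludes going back. *)
have shift m : ((2 * p).-1 <= m)%N -> r0 (r1 (c m)) = c m.+2 /\ r0 (r1 (c m.+1)) = c m.+3.
  elim: m => [|m IHm]; first by lia.
  rewrite leq_eqVlt => /predU1P[em|lt_m].
    have e1 : m.+3 = (1 + 2 * p)%N by lia.
    have e2 : m.+2 = (0 + 2 * p)%N by lia.
    have e4 : m.+4 = (2 + 2 * p)%N by lia.
    by rewrite -em e1p r01 em e4 e1 e2 !perE r10 e00.
  have [h0 h1] := IHm lt_m; split=> //.
  have [|||||h|h] := nbr (r0 \o r1) m.+1 m.+2 m.+3 (aut_comp a0 a1) => //=.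
  - by rewrite r1F.
  - by rewrite r1G.
  - by rewrite comparable_sym.
  - by move=> e; apply: (ne1 m.+1).
  move: h; have -> : (m.+3 + (2 * p).-1 = m.+2 + 2 * p)%N by lia.
  rewrite perE -h0 => /(aut_inj a0)/(aut_inj a1) e.
  have lt2 : (0 < 2 < 2 * p)%N by lia.
  by case: (neD m 2 lt2); rewrite addn2 -e.
move=> m; have [|h _] := shift (m + 2 * p)%N; first by lia.
by move: h; rewrite -!addSn !perE.
Qed.

(** The power [a] moves [c m] to [c (m + 2 * a)], and indices count modulo [2 * p]. *)
Lemma rotation_iter_fix F G p v e r0 r1 : is_polygon_section F G p ->
  automorphism r0 -> automorphism r1 ->
  r0 F = F -> r0 G = G -> r1 F = F -> r1 G = G ->
  F < v -> v < e -> e < G ->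
  r0 e = e -> r0 v <> v -> r1 v = v -> r1 e <> e ->
  (1 < p)%N /\ forall a K, K = v \/ K = e -> iter a (r0 \o r1) K = K <-> (p %| a)%N.
Proof.
move=> Ppol a0 a1 r0F r0G r1F r1G Fv ve eG r0e r0v r1v r1e.
have vFG : F < v < G by rewrite Fv (lt_trans ve eG).
have eFG : F < e < G by rewrite eG (lt_trans Fv ve).
(* A 0-gon has only its two improper faces, which leaves no place for [v]. *)
have p0 : (0 < p)%N.
  case: (p) Ppol => // -[f [fle frange]].
  have sec K : F <= K <= G -> exists x, f x = K.
    by move=> FKG; have: section F G K by []; rewrite -frange => -[x _ <-]; exists x.
  have leFG : F <= G by case/andP: vFG => /lt_trans h /h /ltW.
  have [|x ex] := sec v; first by rewrite !ltW //; case/andP: vFG.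
  have [|y ey] := sec F; first by rewrite lexx.
  have [|z ez] := sec G; first by rewrite lexx andbT.
  case/andP: vFG => vF vG; case: x ex => [|[]|[]|] // ex.
    by move: vF; rewrite -ex -ey lt_leAnge !fle /= andbF.
  by move: vG; rewrite -ex -ez lt_leAnge !fle andbC; case: (z).
have [||c [cW c0 c1]] := polygon_walk_from p0 Ppol vFG eFG.
- by rewrite /Order.comparable (ltW ve).
- by move=> e_v; move: ve; rewrite e_v ltxx.
have [||||p1 shift] := rotation_walk cW p0 a0 a1 r0F r0G r1F r1G; rewrite ?c0 ?c1 //.
split=> // a K vK; have [m m1 <-] : exists2 m, (m <= 1)%N & c m = K.
  by case: vK => ->; [exists 0%N | exists 1%N].
have ->: iter a (r0 \o r1) (c m) = c (m + 2 * a)%N.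
  elim: a => [|a IHa]; first by rewrite muln0 addn0.
  by rewrite iterS IHa /= shift; congr c; lia.
have [cE _ _ _] := cW; rewrite cE.
have ->: (p %| a)%N = (m + 2 * a == m + 0 %[mod 2 * p])%N.
  by rewrite eqn_modDl mod0n -(@dvdn_pmul2l 2).
by rewrite addn0; split=> /eqP.
Qed.
End PolygonWalk.

(** * The rotation subgroup *)

Section FunctionGroups.
Context {n : nat} {P : abstract_polytope n}.
Implicit Types A B : set (P -> P).

(* The regular representation of A by right translation; [theta] recovers a
   function from the image of the identity. *)
Lemma function_group_perm A N : is_function_group A ->
  (forall f, A f -> bijective f) -> A #<= `I_N ->
  exists (gT : finGroupType) (G : {group gT}) (theta : gT -> P -> P),
    [/\ (#|G| <= N)%N, theta 1%g = id,
        {in G &, forall s t : gT, theta (s * t)%g = theta s \o theta t},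
        {in G &, injective theta}
      & forall f, A f <-> exists2 s, s \in G & theta s = f].
Proof.
case=> A1 AM AV Abij leN.
have /finite_setP[M AsM] : finite_set A by apply: card_le_finite leN _; apply: finite_II.
have leMN : (M <= N)%N by rewrite -card_le_II -(card_le_eql AsM).
have /card_set_bijP[g [gI gJ gS]] := AsM.
have /choice[e eP] : forall k : 'I_M, exists f, A f /\ g f = k.
  by move=> k; have [f Af gf] := gS k (ltn_ord k); exists f.
have eA k : A (e k) by case: (eP k).
have ge k : g (e k) = k by case: (eP k).
have e_inj : injective e by move=> k l ekl; apply: ord_inj; rewrite -!ge ekl.
have eS f : A f -> exists k, e k = f.
  move=> Af; exists (Ordinal (gI f Af)); apply: gJ; rewrite ?inE ?ge //.
have [i0 ei0] := eS id A1.
(* [e] enumerates [A], with [e i0] the identity; these are the permutations of indices acting as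
   right translation by [e (s i0)]. *)
pose G := [set s : 'S_M | [forall i, `[< e (s i) = e i \o e (s i0) >]]]%SET.
have GP (s : 'S_M) : s \in G -> forall i, e (s i) = e i \o e (s i0).
  by rewrite inE => /forallP sG i; apply/asboolP.
have PG (s : 'S_M) f : (forall i, e (s i) = e i \o f) -> s \in G.
  move=> sf; rewrite inE; apply/forallP => i; apply/asboolP.
  by rewrite !sf ei0.
have Gg : group_set G.
  apply/group_setP; split.
    by apply: (PG _ id) => i; rewrite perm1.
  move=> s t sG tG; apply: (PG _ (e (s i0) \o e (t i0))) => i.
  by rewrite permM (GP t) // (GP s).
(* Permutations compose left factor first, so right translation preserves the order of products. *)
have thM : {in G &, forall s t : 'S_M, e ((s * t)%g i0) = e (s i0) \o e (t i0)}.
  by move=> s t sG tG; rewrite permM (GP t).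
have thI : {in G &, injective (fun s : 'S_M => e (s i0))}.
  move=> s t sG tG est; apply/permP => i; apply: e_inj.
  by rewrite (GP s) // (GP t) // est.
exists 'S_M, (group Gg), (fun s : 'S_M => e (s i0)); split=> //.
- rewrite (leq_trans _ leMN) // -[X in (_ <= X)%N]card_ord.
  rewrite -(card_in_imset (f := fun s : 'S_M => s i0) (D := G)) ?max_card //.
  by move=> s t sG tG est; apply: thI; rewrite // est.
- by rewrite perm1.
move=> f; split=> [Af|[s _ <-] //].
have [h hK Kh] := Abij f Af.
have /choice[r rP] : forall i, exists k, e k = e i \o f by move=> i; apply/eS/AM.
have r_inj : injective r.
  move=> i j erij; apply: e_inj; apply/funext => x.
  have := congr1 (fun u => e u (h x)) erij.
  by rewrite /= !rP /= !Kh.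
have sG : perm r_inj \in G by apply: (PG _ f) => i; rewrite permE.
by exists (perm r_inj) => //; rewrite permE rP ei0.
Qed.

Lemma rotations_function_group (rho : nat -> P -> P) : is_function_group (rotations rho).
Proof.
split.
- by move=> B [[]].
- by move=> f g Af Ag B BP; have [[_ BM _] _] := BP; apply: BM; [apply: Af | apply: Ag].
- by move=> f g Af fK gK B BP; have [[_ _ BV] _] := BP; apply: BV (Af _ BP) fK gK.
Qed.

(** The only left coset of [A] in itself is [A]; hence a subgroup of index two is proper. *)
Lemma left_cosets_self A : is_function_group A -> (forall f, A f -> bijective f) ->
  ~ (left_cosets A A #= `I_2).
Proof.
move=> [A1 AM AV] Abij /card_set_bijP[g [gI _ gS]].
have E D : left_cosets A A D -> D = A.
  case=> f Af <-; apply/seteqP; split=> [_ [h Ah <-]|h Ah]; first exact: AM.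
  have [f' fK Kf] := Abij f Af; exists (f' \o h); first exact: AM (AV _ _ Af fK Kf) Ah.
  by apply/funext => x; rewrite /= Kf.
have [D0 /E-> g0] := gS 0%N isT; have [D1 /E-> g1] := gS 1%N isT.
by rewrite g0 in g1.
Qed.

End FunctionGroups.

(** * The action of automorphisms on flags *)

Section Automorphisms.
Context {n : nat} (P : abstract_polytope n).
Implicit Types (f : P -> P) (C : set P) (b : nat -> P).

Lemma aut_function_group : is_function_group (automorphisms P).
Proof.
split; first by split; [exists id | move=> F G].
  by move=> f g; apply: aut_comp.
move=> f g [fB fM] fK gK; split; first by exists f.
by move=> F G; rewrite -{2}(gK F) -{2}(gK G) fM.
Qed.

Lemma aut_flag f C : automorphism f -> is_flag C -> is_flag (f @` C).
Proof.
move=> fA [chC maxC]; have [[g fK gK] fM] := fA; split.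
  by move=> _ _ [F CF <-] [G CG <-]; rewrite !fM; apply: chC.
move=> D chD sCD F DF; exists (g F); last exact: gK.
apply: (maxC (g @` D)).
- move=> _ _ [H DH <-] [K DK <-].
  by rewrite -(fM (g H)) -(fM (g K)) !gK; apply: chD.
- by move=> H CH; exists (f H); [apply: sCD; exists H | exact: fK].
- by exists F.
Qed.

(** Automorphisms with the same image of [C] differ by one that maps [C] to itself; it preserves
    ranks, so it fixes each face of [C] and is the identity. *)
Lemma card_aut_le C N : is_flag C -> flags P #= `I_N -> automorphisms P #<= `I_N.
Proof.
move=> flC cardN; have [b [bC br bE]] := flag_faces flC.
have bl := flag_faces_lt flC bC br.
have imI : {in automorphisms P &, injective (fun f => f @` C)}.
  move=> f h /set_mem fA /set_mem hA efh.
  have [g hK gK] := proj1 hA.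
  have gA : automorphism g by have [_ _ AV] := aut_function_group; apply: AV hA hK gK.
  have gf : g \o f = id.
    apply: (aut_fix_flag br bl (aut_comp gA fA)) => j le_j.
    have : (h @` C) (f (b j)) by rewrite -efh; exists (b j) => //; apply: bC.
    case=> _ /bE[k le_k ->] ehf; rewrite /= -ehf hK; congr b.
    by have := congr1 (@rank n P) ehf; rewrite !aut_rank // !br //; lia.
  by apply/funext => x; rewrite -[f x]gK -/((g \o f) x) gf.
rewrite -(card_le_eql (inj_card_eq imI)) -(card_le_eqr cardN).
by apply: subset_card_le => _ [f fA <-]; apply: aut_flag.
Qed.

(** The base face of rank [i] has index [i.+1]. Were it fixed too, [rho i] would leave [C]
    unchanged. *)
Lemma reflection_faces C rho b i : is_flag C -> reflections C rho ->
  (forall j, (j <= n.+1)%N -> C (b j)) ->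
  (forall j, (j <= n.+1)%N -> rank (b j) = (j%:Z - 1)%R) ->
  (forall F, C F -> exists2 j, (j <= n.+1)%N & F = b j) ->
  (i < n)%N ->
  [/\ automorphism (rho i),
      forall j, (j <= n.+1)%N -> j != i.+1 -> rho i (b j) = b j
    & rho i (b i.+1) <> b i.+1].
Proof.
move=> flC rhoC bC br bE lt_in; have [rA [_ _ neC adj]] := rhoC i lt_in.
have fixb j : (j <= n.+1)%N -> j != i.+1 -> rho i (b j) = b j.
  move=> le_j ne_j; have : (rho i @` C) (b j).
    by apply/adj; [rewrite br //; lia | apply: bC].
  case=> _ /bE[k le_k ->] e; rewrite -{2}e; congr (rho i (b _)).
  by have := congr1 (@rank n P) e; rewrite aut_rank // !br //; lia.
split=> // e; apply: neC; apply/seteqP.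
have fixb' j : (j <= n.+1)%N -> rho i (b j) = b j.
  by case: (eqVneq j i.+1) => [->|ne_j le_j]; [rewrite e | apply: fixb].
split=> [_ /bE[j le_j ->]|_ [_ /bE[j le_j ->] <-]]; last by rewrite fixb' //; apply: bC.
by exists (b j); [apply: bC | rewrite fixb'].
Qed.

End Automorphisms.

(** * The rotation group of a tight polytope *)

Section TightRotations.
Context {n : nat} (P : abstract_polytope n) (p : (n.-1).-tuple nat).

(** Collects all that the group-theoretic argument takes from the polytope; counting from 0, [x i]
    represents [rho i \o rho i.+1]. *)
Lemma tight_rotation_group : tight P p -> orientably_regular P ->
  exists (gT : finGroupType) (x : nat -> gT),
    (forall i, (i < n.-1)%N -> #[x i]%g = nth 0%N p i /\ (1 < nth 0%N p i)%N) /\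
    (forall i, (i.+1 < n.-1)%N ->
      [/\ <[x i]> * <[x i.+1]> = <[x i]> <*> <[x i.+1]>,
          <[x i]> :&: <[x i.+1]> = 1 & (x i * x i.+1) ^+ 2 = 1])%g.
Proof.
move=> [type_p cardN] [_ [C [rho [flC rhoC index2]]]].
have [b [bC br bE]] := flag_faces flC.
have bl := flag_faces_lt flC bC br.
have rhoP i := reflection_faces flC rhoC bC br bE (i := i).
have rhoA i : (i < n)%N -> automorphism (rho i) by case/rhoP.
have rfix i j : (i < n)%N -> (j <= n.+1)%N -> j != i.+1 -> rho i (b j) = b j.
  by case/rhoP => _ h _; apply: h.
have autG := aut_function_group P.
have autB (f : P -> P) : automorphisms P f -> bijective f by case.
have [gT [G [theta [leG th1 thM thI thE]]]] :=
  function_group_perm autG autB (card_aut_le flC cardN).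
have rotG := rotations_function_group rho.
have rotA f : rotations rho f -> automorphisms P f.
  apply; split=> // _ [i /andP[i0 lt_in] ->].
  by apply: aut_comp; apply: rhoA; lia.
have thA s : s \in G -> automorphism (theta s) by move=> sG; apply/thE; exists s.
pose R := [set s in G | `[< rotations rho (theta s) >]]%SET.
have Rg : group_set R.
  have [R1 RM _] := rotG; apply/group_setP; split.
    by rewrite inE group1; apply/asboolP; rewrite th1.
  move=> s t; rewrite !inE => /andP[sG /asboolP sR] /andP[tG /asboolP tR].
  by rewrite groupM //=; apply/asboolP; rewrite thM //; apply: RM.
have leR : (#|group Rg| <= \prod_(i < n.-1) nth 0%N p i)%N.
  have sRG : group Rg \subset G by apply/fintype.subsetP=> s; rewrite inE => /andP[].
  (* The index is at least 2, which cancels the factor 2 in the number of flags. *)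
  have ne_RG : (1 < indexg G (group Rg))%N.
    rewrite indexg_gt1; apply/negP=> /fintype.subsetP sGR.
    apply: (left_cosets_self autG autB); suff: rotations rho = automorphisms P.
      by move=> e; rewrite -{2}e.
    apply/seteqP; split=> // f /thE[s sG <-].
    by have := sGR s sG; rewrite inE => /andP[_ /asboolP].
  have := leq_trans (eq_leq (Lagrange sRG)) leG; rewrite big_tuple.
  under eq_bigr => i _ do rewrite (tnth_nth 0%N).
  move=> le2; rewrite -(leq_pmul2l (ltn0Sn 1)) (leq_trans _ le2) // mulnC.
  by rewrite leq_pmul2l.
have /choice[x xP] : forall i, exists s,
    (i < n.-1)%N -> s \in G /\ theta s = rho i \o rho i.+1.
  move=> i; have [lt_i|ge_i] := ltnP i n.-1; last by exists 1%g.
  have [s sG es] : exists2 s, s \in G & theta s = rho i \o rho i.+1.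
    by apply/thE/aut_comp; apply: rhoA; lia.
  by exists s.
have xG i : (i < n.-1)%N -> x i \in G by case/xP.
have thX s a : s \in G -> theta (s ^+ a)%g = iter a (theta s).
  move=> sG; elim: a => [|a IHa]; first by rewrite expg0 th1.
  by rewrite expgS thM ?groupX // IHa; apply/funext.
have xb i j : (i < n.-1)%N -> (j <= n.+1)%N -> j != i.+1 -> j != i.+2 ->
    theta (x i) (b j) = b j.
  by move=> lt_i le_j j1 j2; have [_ ->] := xP i lt_i; rewrite /= !rfix //; lia.
have fix_id s : s \in G -> (forall j, (j <= n.+1)%N -> theta s (b j) = b j) -> s = 1%g.
  move=> sG sb; apply: thI => //.
  by rewrite th1; apply: (aut_fix_flag br bl) sb; apply: thA.
have iter_fix i K a : theta (x i) K = K -> iter a (theta (x i)) K = K.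
  by move=> e; elim: a => // a IHa; rewrite iterS IHa.
have rot i : (i < n.-1)%N -> (1 < nth 0%N p i)%N /\
    forall a K, K = b i.+1 \/ K = b i.+2 ->
      theta (x i ^+ a)%g K = K <-> (nth 0%N p i %| a)%N.
  move=> lt_i; have [xiG ex] := xP i lt_i.
  have [|a0 _ m0] := rhoP i; first by lia.
  have [|a1 _ m1] := rhoP i.+1; first by lia.
  (* These faces have ranks [i - 1] and [i + 2], the bounds of a section governed by entry [i] of
     the type. *)
  have bi : b i < b i.+3 by apply: bl; lia.
  have pol : is_polygon_section (b i) (b i.+3) (nth 0%N p i).
    rewrite -(tnth_nth 0%N p (Ordinal lt_i)); apply: type_p (ltW bi) _ _.
      by rewrite br /=; lia.
    by rewrite br /=; lia.
  have [|||||||||||p1 it] := rotation_iter_fix (v := b i.+1) (e := b i.+2)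
    pol a0 a1; try (by apply: rfix; lia); try (by apply: bl; lia); try by [].
  by split=> // a K /it <-; rewrite thX // ex.
have order_x i a : (i < n.-1)%N -> (x i ^+ a == 1)%g = (nth 0%N p i %| a)%N.
  move=> lt_i; have [p1 it] := rot i lt_i; apply/eqP/idP => [xa|pa].
    by apply/(it a (b i.+1)); [left | rewrite xa th1].
  (* The base faces [b i.+1] and [b i.+2] return by divisibility, and [x i] fixes all others, so
     rigidity applies. *)
  apply: fix_id => [|j le_j]; first by rewrite groupX ?xG.
  have [e1|e1] := eqVneq j i.+1; first by apply/it; rewrite // e1; left.
  have [e2|e2] := eqVneq j i.+2; first by apply/it; rewrite // e2; right.
  by rewrite thX ?xG // iter_fix // xb.
have orderE i : (i < n.-1)%N -> #[x i]%g = nth 0%N p i.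
  by move=> lt_i; apply/eqP; rewrite eqn_dvd order_dvdn order_x // dvdnn /= -order_x // expg_order.
pose S j := [set s in G | `[< theta s (b j.+1) = b j.+1 >]]%SET.
have Sg j : group_set (S j).
  apply/group_setP; split; first by rewrite inE group1; apply/asboolP; rewrite th1.
  move=> s t; rewrite !inE => /andP[sG /asboolP sb] /andP[tG /asboolP tb].
  by rewrite groupM //=; apply/asboolP; rewrite thM //= tb.
have tiS i j : (i < n.-1)%N -> j = i \/ j = i.+1 -> (<[x i]> :&: group (Sg j) = 1)%g.
  move=> lt_i ij; apply/trivgP/fintype.subsetP=> _ /setIP[/cycleP[a ->]].
  rewrite !inE => /andP[_ /asboolP h]; rewrite order_x //.
  have [_ it] := rot i lt_i; apply/(it a (b j.+1)) => //.
  by case: ij => ->; [left | right].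
have xR i : (i < n.-1)%N -> x i \in group Rg.
  move=> lt_i; have [xiG ex] := xP i lt_i; rewrite inE xiG; apply/asboolP.
  by move=> B [_]; apply; exists i.+1; rewrite ?ex //; lia.
have xS i j : (i < n.-1)%N -> (j <= n.-1)%N -> j != i -> j != i.+1 -> x i \in group (Sg j).
  move=> lt_i le_j j0 j1; rewrite inE xG //; apply/asboolP.
  by apply: xb => //; lia.
have leX : (#|group Rg| <= \prod_(i < n.-1) #[x i]%g)%N.
  by rewrite (eq_bigr (fun i : 'I_n.-1 => nth 0%N p i)) // => i _; rewrite orderE.
exists gT, x; split=> [i lt_i|i lt_i]; first by rewrite orderE //; case: (rot i lt_i).
split.
- apply: (joing_consecutive_cycles xR xS _ _ leX) lt_i => j lt_j; apply: tiS => //; by [left | right].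
- by apply: (consecutive_cycles_TI xS _ lt_i) => j lt_j; apply: tiS => //; left.
have sq_id f : automorphism f -> f (b 0%N) = b 0%N -> f (b n.+1) = b n.+1 ->
  (forall j, (j < n)%N ->
    f (b j.+1) = b j.+1 \/ f (b j) = b j /\ f (b j.+2) = b j.+2) ->
  f \o f = id by apply: (aut_sq_id br bl).
have [xiG ei] := xP i (ltnW lt_i); have [xjG ej] := xP i.+1 lt_i.
have [a0 a1 a2] : [/\ automorphism (rho i), automorphism (rho i.+1) & automorphism (rho i.+2)].
  by split; apply: rhoA; lia.
have rho1 K : rho i.+1 (rho i.+1 K) = K.
  suff e : rho i.+1 \o rho i.+1 = id by rewrite -[LHS]/((rho i.+1 \o rho i.+1) K) e.
  apply: sq_id => // [||j lt_j]; try by apply: rfix; lia.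
  have [->|ne_j] := eqVneq j i.+1; last by left; apply: rfix; lia.
  by right; split; apply: rfix; lia.
(* The two middle reflections cancel. *)
have xy : theta (x i * x i.+1)%g = rho i \o rho i.+2.
  by rewrite thM // ei ej; apply/funext => K /=; rewrite rho1.
apply: thI; rewrite ?groupX ?groupM //.
rewrite expgS expg1 thM ?groupM // xy th1.
apply: sq_id => [|||j lt_j]; first exact: aut_comp.
- by rewrite /= !rfix //; lia.
- by rewrite /= !rfix //; lia.
(* Only [b i.+1] and [b i.+3] can move, and the neighbours of each in the flag are fixed. *)
have [->|n0] := eqVneq j i.
  by right; rewrite /= !rfix //; lia.
have [->|n2] := eqVneq j i.+2.
  by right; rewrite /= !rfix //; lia.
by left; rewrite /= !rfix //; lia.
Qed.

End TightRotations.

Theorem theorem4p1 (n : nat) (P : abstract_polytope n) (p : (n.-1).-tuple nat) :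
  tight P p -> orientably_regular P -> admissible p.
Proof.
move=> tP oP; have [gT [x [xo xx]]] := tight_rotation_group tP oP.
move=> i j; rewrite size_tuple => lt_i lt_j ij odd_i.
have [oi pi1] := xo i lt_i; have [oj _] := xo j lt_j.
rewrite -oi in odd_i pi1 *; rewrite -oj.
have xi1 : (x i != 1)%g by rewrite -order_eq1; lia.
have [defG ti xy2] : [/\ <[x i]> * <[x j]> = <[x i]> <*> <[x j]>,
    <[x i]> :&: <[x j]> = 1 & (x i * x j) ^+ 2 = 1]%g.
  (* When [j] precedes [i], the two cyclic groups permute because their product is a group, and
     [x i * x j] is a conjugate of [x j * x i]. *)
  case: ij => e; first by rewrite e; apply: xx; rewrite -e.
  have [|defG ti xy2] := xx j; first by rewrite -e.
  rewrite -e in defG ti xy2; split.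
  - rewrite joingC -defG; apply/esym/comm_group_setP; rewrite defG; exact: groupP.
  - by rewrite finset.setIC.
  have -> : (x i * x j = (x j * x i) ^ x j)%g by rewrite conjgE -mulgA mulKg.
  by rewrite -conjXg xy2 conj1g.
split; first exact: odd_cycle_product_even defG ti xy2 odd_i xi1.
exact: odd_cycle_product_dvd defG xy2 odd_i.
Qed.
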